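(* There exists a maximum class of VC-dimension $3$ that has no corner. (That is, there exist a finite set $X$ and a concept class $C\subseteq 2^{X}$ which is maximum, has VC-dimension $3$, and contains no corner.)
   Context: Let $X$ be a finite set with $n=|X|$. A concept class is a family $C\subseteq 2^X$ of subsets of $X$ (concepts). For $Y\subseteq X$ let $C|Y=\{c\cap Y: c\in C\}$. A set $Y\subseteq X$ is shattered by $C$ if $C|Y=2^Y$. The VC-dimension of $C$ is the largest size $d$ of a set shattered by $C$. $C$ is maximum if $|C|=\sum_{i=0}^{d}\binom{n}{i}$, where $d$ is the VC-dimension of $C$. A cube of $2^X$ is a set of the form $B=\{T\cup Z: Z\subseteq Y\}$ with $Y\subseteq X$ and $T\subseteq X\setminus Y$; $Y$ is its support. A cube of $C$ is a cube $B$ of $2^X$ with $B\subseteq C$. A concept $c\in C$ is a corner of $C$ if $c$ belongs to exactly one inclusion-maximal cube of $C$. *)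

(* Defs.v *)
From mathcomp Require Import all_boot.
Set Implicit Arguments. Unset Strict Implicit. Unset Printing Implicit Defensive.

Section VC.
Variable X : finType.
Implicit Types (C B : {set {set X}}) (Y T c : {set X}).

Definition restr C Y : {set {set X}} := [set c :&: Y | c in C].

Definition shattered C Y : Prop := restr C Y = powerset Y.

(* VC-dimension: the largest size of a shattered set (0 if none) *)
Definition vcdim C : nat :=
  \max_(Y : {set X} | restr C Y == powerset Y) #|Y|.

Definition maximum C : Prop :=
  #|C| = \sum_(i < (vcdim C).+1) 'C(#|X|, i).

Definition is_cube B : Prop :=
  exists Y T, T \subset ~: Y /\ B = [set T :|: Z | Z in powerset Y].

Definition cube_of C B : Prop := is_cube B /\ B \subset C.

Definition maximal_cube_of C B : Prop :=
  cube_of C B /\ forall B', cube_of C B' -> B \subset B' -> B' = B.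

Definition corner C c : Prop :=
  c \in C /\ exists! B, maximal_cube_of C B /\ c \in B.

End VC.

(* Main.v *)
Require Import Defs.
From mathcomp Require Import all_boot.
From Stdlib Require Import NArith.

(* Supports of cubes of C are shattered by C, so a concept c lying in a unique maximal cube
   has all its neighbours in C inside that cube, and hence has at most vcdim C of
   them.  It therefore suffices to exhibit a maximum class of VC-dimension 3 in
   which every concept has at least 4 neighbours. *)

Set Implicit Arguments.
Unset Strict Implicit.
Unset Printing Implicit Defensive.

(** * Shattering, cubes and corners in an arbitrary class *)

Section VCdim.
Variable X : finType.
Implicit Types (C B : {set {set X}}) (Y T c : {set X}) (i : X).

Lemma shatteredP C Y :
  reflect (forall A : {set X}, A \subset Y -> exists2 c, c \in C & c :&: Y = A)
          (restr C Y == powerset Y).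
Proof.
apply: (iffP eqP) => [sh A sAY | sh].
  by move: sAY; rewrite -powersetE -sh => /imsetP[c cC ->]; exists c.
apply/setP=> A; rewrite powersetE; apply/imsetP/idP => [[c _ ->]|/sh[c cC <-]].
  exact: subsetIr.
by exists c.
Qed.

Lemma shattered_sub C Y Y' : Y' \subset Y ->
  restr C Y == powerset Y -> restr C Y' == powerset Y'.
Proof.
move=> sY /shatteredP sh; apply/shatteredP=> A sA.
have [c cC cY] := sh A (subset_trans sA sY); exists c => //.
by rewrite -(setIidPr sY) setIA cY; apply/setIidPl.
Qed.

Lemma leq_vcdim C Y : restr C Y == powerset Y -> #|Y| <= vcdim C.
Proof.
exact: (@leq_bigmax_cond _ (fun Y => restr C Y == powerset Y) (fun Y => #|Y|)).
Qed.

(** Shattering passes to subsets, so a larger shattered set would contain a shattered one of size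
    exactly [d.+1]. *)
Lemma vcdim_ltn C d :
  (forall Y, #|Y| = d.+1 -> restr C Y != powerset Y) -> vcdim C <= d.
Proof.
move=> noY; apply/bigmax_leqP=> Y shY; rewrite leqNgt; apply/negP=> ltdY.
have [s [us ss sY]] : exists s, [/\ uniq s, size s = d.+1 & {subset s <= Y}].
  exists (take d.+1 (enum Y)); split; first by rewrite take_uniq ?enum_uniq.
    by rewrite size_takel // -cardE.
  by move=> x /mem_take; rewrite mem_enum.
have sub : [set x in s] \subset Y.
  by apply/subsetP=> x; rewrite inE => /sY.
have := noY [set x in s]; rewrite (shattered_sub sub shY) cardsE => /(_ _)/negP.
by rewrite (card_uniqP us) => /(_ ss); apply.
Qed.

Definition flip c i : {set X} := [set j | (j == i) (+) (j \in c)].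

Lemma in_flip c i : (i \in flip c i) = (i \notin c).
Proof. by rewrite inE eqxx. Qed.

Lemma cube_of_edge C c i : c \in C -> flip c i \in C ->
  cube_of C [set c; flip c i].
Proof.
move=> cC fC; split; last by apply/subsetP=> x /set2P[] ->.
exists [set i], (c :\ i); split.
  by apply/subsetP=> j; rewrite !inE => /andP[].
rewrite powerset1 imsetU1 imset_set1 setU0.
(* The base point [c :\ i] is [flip c i] when [i] lies in [c], and [c] itself otherwise. *)
case ic: (i \in c); first rewrite setUC.
all: congr ([set _] :|: [set _]); apply/setP=> j; rewrite !inE.
all: by case: eqP => [->|]; rewrite ?ic ?orbF ?orbT.
Qed.

Lemma cube_of_sub_maximal C B : cube_of C B ->
  exists2 B', maximal_cube_of C B' & B \subset B'.
Proof.
move=> [[Y [T [sT eB]]] sBC].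
(* A Boolean form of [cube_of], so that [maxset_exists] applies. *)
pose cubeb (D : {set {set X}}) := (D \subset C) &&
  [exists Y : {set X}, exists T : {set X},
    (T \subset ~: Y) && (D == [set T :|: Z | Z in powerset Y])].
have cubeP D : reflect (cube_of C D) (cubeb D).
  apply: (iffP andP) => [[sD /existsP[Y' /existsP[T' /andP[? /eqP ?]]]] |].
    by split=> //; exists Y', T'.
  case=> [[Y' [T' [sT' eD]]] sD]; split=> //.
  by apply/existsP; exists Y'; apply/existsP; exists T'; rewrite sT' eD eqxx.
have cB : cubeb B by apply/cubeP; split=> //; exists Y, T.
have [B' maxB' sB] := maxset_exists cB; exists B' => //.
have /maxsetP[/cubeP cB' maxi] := maxB'.
by split=> // D /cubeP cD; apply: maxi.
Qed.

Lemma not_corner C c :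
  (c \in C -> vcdim C < #|[set i | flip c i \in C]|) -> ~ corner C c.
Proof.
move=> lt [cC [B [[[[[Y [T [sTY eB]]] sBC] _] cB] uniB]]].
have edges : [set i | flip c i \in C] \subset Y.
  apply/subsetP=> i; rewrite inE => fC.
  (* The edge from [c] to [flip c i] extends to a maximal cube containing [c], which by uniqueness
     is [B]. *)
  have [B' maxB'] := cube_of_sub_maximal (cube_of_edge cC fC).
  rewrite subUset !sub1set => /andP[cB' fB'].
  move: fB' cB; rewrite -(uniB B' (conj maxB' cB')) eB.
  move=> /imsetP[Z1]; rewrite powersetE => sZ1 e1.
  move=> /imsetP[Z2]; rewrite powersetE => sZ2 e2.
  (* Outside the support [Y] all members of [B] agree with [T], whereas [c] and [flip c i] differ at
     [i]. *)
  apply/negPn/negP=> iY; have := in_flip c i; rewrite e1 {1}e2 !inE.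
  have /negPf-> : i \notin Z1 by apply: contra iY => /(subsetP sZ1).
  have /negPf-> : i \notin Z2 by apply: contra iY => /(subsetP sZ2).
  by rewrite !orbF; case: (i \in T).
have shY : restr C Y == powerset Y.
  apply/shatteredP=> A sA; exists (T :|: A).
    by apply: (subsetP sBC); rewrite eB imset_f // powersetE.
  rewrite setIUl (setIidPl sA).
  have -> : T :&: Y = set0 by apply: disjoint_setI0; rewrite disjoints_subset.
  by rewrite set0U.
have := leq_trans (lt cC) (subset_leq_card edges).
by rewrite ltnNge leq_vcdim.
Qed.

End VCdim.

(** * Subsets of ['I_n] as Boolean words *)

Section Words.
Variable n : nat.
Implicit Types (A Y : {set 'I_n}) (s p m : seq bool) (L : seq (seq bool)).

Definition word A : seq bool := [seq i \in A | i <- enum 'I_n].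
Definition set_of s : {set 'I_n} := [set i : 'I_n | nth false s i].
Definition class_of L : {set {set 'I_n}} := [set A : {set 'I_n} | word A \in L].

Lemma size_word A : size (word A) = n.
Proof. by rewrite size_map size_enum_ord. Qed.

Lemma nth_word A (i : 'I_n) : nth false (word A) i = (i \in A).
Proof. by rewrite (nth_map i) ?size_enum_ord // nth_ord_enum. Qed.

Lemma set_ofK s : size s = n -> word (set_of s) = s.
Proof.
move=> ss; apply: (@eq_from_nth _ false) => [|i]; rewrite size_word ?ss // => ltin.
by rewrite (nth_word _ (Ordinal ltin)) inE.
Qed.

Lemma wordK : cancel word set_of.
Proof. by move=> A; apply/setP=> i; rewrite inE nth_word. Qed.

Lemma card_class_of L : uniq L -> all (fun s => size s == n) L ->
  #|class_of L| = size L.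
Proof.
move=> uL /allP sL.
have uM : uniq (map set_of L).
  rewrite map_inj_in_uniq // => s t /sL/eqP ss /sL/eqP st e.
  by rewrite -(set_ofK ss) e set_ofK.
rewrite -(size_map set_of) -(card_uniqP uM); apply: eq_card => A; rewrite inE.
apply/idP/mapP => [AL | [s sIL ->]]; first by exists (word A); rewrite ?wordK.
by rewrite set_ofK //; apply/eqP/sL.
Qed.

Lemma mask_word A Y : mask (word Y) (word A) = [seq i \in A | i <- enum Y].
Proof.
by rewrite /word -map_mask -filter_mask enumT.
Qed.

(** Makes traces on [Y] computable: masking by [word Y] lists exactly the membership values on
    [Y]. *)
Lemma eq_mask_word A A' Y :
  (mask (word Y) (word A) = mask (word Y) (word A')) <-> (A :&: Y = A' :&: Y).
Proof.
rewrite !mask_word; split=> [/eq_in_map e | e].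
  apply/setP=> i; rewrite !inE; case iY: (i \in Y); rewrite ?andbF //.
  by rewrite !andbT; apply: e; rewrite mem_enum.
apply/eq_in_map=> i; rewrite mem_enum => iY.
by have /setP/(_ i) := e; rewrite !inE iY !andbT.
Qed.

Lemma count_word Y : count id (word Y) = #|Y|.
Proof. by rewrite count_map cardE -size_filter enumT. Qed.

End Words.

(** * A computable test that no set of a given size is shattered *)

Lemma mask_surj (m p : seq bool) : size p = count id m ->
  exists2 z, size z = size m & mask m z = p.
Proof.
elim: m p => [|[] m IH] p /=.
- by move/eqP; rewrite size_eq0 => /eqP->; exists [::].
- case: p => // b p [/IH[z sz <-]]; by exists (b :: z); rewrite /= ?sz.
(* Unselected positions are padded with [false]. *)
- by rewrite add0n => /IH[z sz <-]; exists (false :: z); rewrite /= ?sz.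
Qed.

(** Both halves are kept even when empty: an empty cell is the evidence of a missing pattern. *)
Definition split_head (s : seq (seq bool)) : seq (seq (seq bool)) :=
  [:: [seq behead x | x <- s & head false x];
      [seq behead x | x <- s & ~~ head false x]].

(* [cells] partitions a list of words according to their values on the columns
   selected so far; n columns remain, d of which are still to be selected. *)
Fixpoint unshattered (n d : nat) (cells : seq (seq (seq bool))) : bool :=
  match d, n with
  | 0, _ => has (@nilp _) cells
  | _, 0 => true
  | d'.+1, n'.+1 => unshattered n' d [seq map behead s | s <- cells]
                    && unshattered n' d' (flatten (map split_head cells))
  end.

(** Induction along the columns, with [m] choosing the branch at each one. Once [d] reaches 0, an
    empty cell misses the empty pattern. Going back up, this grows into a pattern missed by one of
    the initial cells. *)
Lemma unshatteredP n d cells m : unshattered n d cells ->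
  all (all (fun x => size x == n)) cells -> size m = n -> count id m = d ->
  exists s p, [/\ s \in cells, size p = d & p \notin map (mask m) s].
Proof.
elim: n d cells m => [|n IH] [|d] cells m /=.
- by move=> /hasP[s sc /nilP s0] _ _ _; exists s, [::]; rewrite sc s0.
- by case: m.
- by move=> /hasP[s sc /nilP s0] _ _ _; exists s, [::]; rewrite sc s0.
case: m => // b m /andP[ua us] szs [sm] cm.
have sz s x : s \in cells -> x \in s -> size x = n.+1.
  by move=> sc xs; apply/eqP; apply: (allP (allP szs s sc)).
case: b cm => /= [[cm]|cm].
  have [|s' [p [s'in sp pn]]] := IH d _ m us _ sm cm.
    apply/allP=> s' /flatten_mapP[s sc s'in]; apply/allP=> y.
    by move: s'in; rewrite !inE => /orP[]/eqP-> /mapP[x];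
       rewrite mem_filter => /andP[_ xs] ->; rewrite size_behead (sz s x).
  have /flatten_mapP[s sc s'h] := s'in.
  (* [b] is the value in the selected column that defines the half [s'] of [s]; prefixing it to [p]
     gives a pattern missing from [s]. *)
  have [b es'] : exists b, s' = [seq behead x | x <- s & head false x == b].
    move: s'h; rewrite !inE => /orP[]/eqP->; [exists true | exists false];
    by congr map; apply: eq_filter => x; case: (head _ _).
  exists s, (b :: p); split; rewrite /= ?sp //.
  apply: contra pn => /mapP[x xs]; have := sz s x sc xs.
  case: x xs => // a x xs _ /= [ea ep].
  rewrite ep map_f // es'; apply/mapP; exists (a :: x) => //.
  by rewrite mem_filter xs /= ea eqxx.
have [|s' [p [/mapP[s sc ->] sp pn]]] := IH d.+1 _ m ua _ sm cm.
  apply/allP=> s' /mapP[s sc ->]; apply/allP=> y /mapP[x xs ->].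
  by rewrite size_behead (sz s x).
exists s, p; split=> //; apply: contra pn => /mapP[x xs].
have := sz s x sc xs; case: x xs => // a x xs _ /= ->.
by rewrite map_f //; apply/mapP; exists (a :: x).
Qed.

(** * VC-dimension and vertex degrees of a class listed by words *)

Section Class.
Variable n : nat.
Implicit Types (A Y : {set 'I_n}) (L : seq (seq bool)).

Lemma vcdim_class_of_leq L d : all (fun s => size s == n) L ->
  unshattered n d.+1 [:: L] -> vcdim (class_of n L) <= d.
Proof.
move=> sL us; apply: vcdim_ltn => Y cY; apply/negP=> /shatteredP sh.
have [|||s [p [sL1 sp pn]]] := unshatteredP (m := word Y) us.
- by rewrite /= sL.
- exact: size_word.
- by rewrite count_word.
rewrite mem_seq1 in sL1; have {sL1} es := eqP sL1; subst s.
(* The missing pattern [p] is padded to a full word, hence is the trace of a set on [Y], which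
   shattering would realise. *)
have [|z sz ez] := @mask_surj (word Y) p; first by rewrite count_word cY.
have [c cL ec] := sh (set_of n z :&: Y) (subsetIr _ _); rewrite inE in cL.
case/negP: pn; apply/mapP; exists (word c) => //.
rewrite -ez -{1}(set_ofK (n := n) (s := z)) ?sz ?size_word //.
exact/esym/eq_mask_word.
Qed.

Lemma vcdim_class_of_geq L m : all (fun s => size s == n) L -> size m = n ->
  (forall p, size p = count id m -> p \in map (mask m) L) ->
  count id m <= vcdim (class_of n L).
Proof.
move=> /allP sL sm allp; have em := set_ofK sm.
rewrite -em count_word; apply/leq_vcdim/shatteredP=> A sA.
have /mapP[s sIL es] : mask m (word A) \in map (mask m) L.
  by apply: allp; rewrite size_mask // sm size_word.
have ss : size s = n by apply/eqP/sL.
exists (set_of n s); first by rewrite inE set_ofK.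
rewrite -[RHS](setIidPl sA); apply/eq_mask_word.
by rewrite em set_ofK.
Qed.

Lemma word_flip A (i : 'I_n) :
  word (flip A i) = set_nth false (word A) i (~~ nth false (word A) i).
Proof.
apply: (@eq_from_nth _ false) => [|j].
  by rewrite size_set_nth !size_word; apply/esym/maxn_idPr.
rewrite size_word => ltjn; rewrite nth_set_nth /= !(nth_word _ (Ordinal ltjn)).
rewrite (nth_word _ i) inE -val_eqE /=; case: eqP => // eji.
by congr (~~ (_ \in A)); apply: val_inj.
Qed.

(** The degree of [s] in the one-inclusion graph of [L]. *)
Definition degree L s : nat :=
  count (fun i => set_nth false s i (~~ nth false s i) \in L) (iota 0 n).

Lemma card_flip_class_of L A :
  #|[set i : 'I_n | flip A i \in class_of n L]| = degree L (word A).
Proof.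
rewrite -count_word /word /degree -val_enum_ord !count_map.
by apply: eq_count => i; rewrite /= !inE word_flip.
Qed.

End Class.

(** * The explicit class and its verification by computation *)

Definition bits (n : nat) (k : N) : seq bool :=
  mkseq (fun i => N.testbit_nat k i) n.

(* Regions of an arrangement of 12 pseudoplanes, i.e. the topes on one side of an
   element g of a uniform oriented matroid of rank 4 on 13 elements: a corner
   would be a simplicial region adjacent to g.  The oriented matroid was found by
   simulated annealing on mutations, minimising the number of such regions among
   the oriented matroids with a symmetry of order 3. *)
Definition L12 : seq (seq bool) := map (bits 12)
  [:: 127; 191; 255; 319; 383; 447; 511; 576; 577; 608; 609; 625; 629; 631; 639; 831; 832;
   833; 836; 837; 848; 852; 853; 864; 865; 868; 869; 880; 881; 884; 885; 887; 895;
   959; 1023; 1151; 1152; 1154; 1160; 1162; 1194; 1195; 1199; 1215; 1216; 1217; 1218;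
   1219; 1224; 1225; 1226; 1227; 1248; 1249; 1251; 1256; 1257; 1258; 1259; 1263; 1279;
   1407; 1535; 1600; 1601; 1603; 1604; 1605; 1607; 1611; 1632; 1633; 1635; 1637; 1639;
   1643; 1647; 1649; 1653; 1655; 1663; 1728; 1729; 1731; 1739; 1760; 1761; 1763; 1771;
   1775; 1791; 1856; 1857; 1860; 1861; 1889; 1893; 1895; 1905; 1909; 1911; 1919; 2047;
   2239; 2303; 2304; 2308; 2320; 2324; 2332; 2334; 2335; 2367; 2432; 2434; 2436; 2438;
   2440; 2442; 2446; 2448; 2450; 2452; 2454; 2456; 2458; 2460; 2462; 2463; 2495; 2559;
   2816; 2818; 2820; 2821; 2822; 2823; 2832; 2836; 2837; 2838; 2839; 2844; 2846; 2847;
   2853; 2869; 2871; 2879; 2880; 2884; 2885; 2896; 2900; 2901; 2917; 2933; 2935; 2943;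
   2944; 2946; 2948; 2950; 2964; 2966; 2967; 2972; 2974; 2975; 3007; 3071; 3200; 3201;
   3202; 3203; 3206; 3207; 3208; 3210; 3211; 3214; 3215; 3222; 3230; 3231; 3242; 3243;
   3247; 3263; 3264; 3265; 3266; 3267; 3274; 3275; 3279; 3306; 3307; 3311; 3327; 3456;
   3458; 3462; 3464; 3466; 3470; 3478; 3486; 3487; 3519; 3583; 3584; 3585; 3586; 3587;
   3588; 3589; 3590; 3591; 3595; 3599; 3606; 3607; 3615; 3621; 3623; 3631; 3639; 3647;
   3648; 3649; 3651; 3652; 3653; 3655; 3659; 3663; 3683; 3685; 3687; 3691; 3695; 3703;
   3711; 3712; 3713; 3714; 3715; 3718; 3719; 3723; 3726; 3727; 3734; 3735; 3742; 3743;
   3759; 3775; 3776; 3777; 3779; 3787; 3791; 3819; 3823; 3839; 3840; 3842; 3844; 3845;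
   3846; 3847; 3861; 3862; 3863; 3871; 3877; 3879; 3893; 3895; 3903; 3904; 3908; 3909;
   3941; 3943; 3957; 3959; 3967; 3968; 3970; 3974; 3990; 3991; 3998; 3999; 4031; 4095]%num.

Lemma size_L12 : all (fun s => size s == 12) L12.
Proof. by vm_compute. Qed.

Lemma uniq_L12 : uniq L12.
Proof. by vm_compute. Qed.

Lemma unshattered_L12 : unshattered 12 4 [:: L12].
Proof. by vm_compute. Qed.

(** The mask selects the first three elements, which form a shattered set; this gives the lower
    bound on the VC-dimension. *)
Lemma patterns_L12 (p : seq bool) : size p = 3 ->
  p \in map (mask (nseq 3 true ++ nseq 9 false)) L12.
Proof.
case: p => [|a [|b [|c []]]] // _.
by move: a b c => [] [] []; vm_compute.
Qed.

Lemma degree_L12 : all (fun s => 3 < degree 12 L12 s) L12.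
Proof. by vm_compute. Qed.

Lemma card_L12 : #|class_of 12 L12| = 299.
Proof. exact: card_class_of uniq_L12 size_L12. Qed.

Lemma vcdim_L12 : vcdim (class_of 12 L12) = 3.
Proof.
apply/anti_leq/andP; split; first exact: vcdim_class_of_leq size_L12 unshattered_L12.
exact: (@vcdim_class_of_geq 12 L12
  (nseq 3 true ++ nseq 9 false) size_L12 erefl patterns_L12).
Qed.

Theorem theorem4p5 :
  exists (X : finType) (C : {set {set X}}),
    maximum C /\ vcdim C = 3 /\ forall c : {set X}, ~ corner C c.
Proof.
exists 'I_12, (class_of 12 L12); rewrite /maximum vcdim_L12 card_L12; split.
  (* The binomial sum is 1 + 12 + 66 + 220 = 299. *)
  by rewrite card_ord !big_ord_recl big_ord0.
split=> // c; apply: not_corner => cL; rewrite inE in cL.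
by rewrite vcdim_L12 card_flip_class_of (allP degree_L12).
Qed.
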